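(* Let $v\in U$ and $\lambda>0$. The gradient projection (GP) algorithm for the non-negativity-constrained TV denoising problem $$\min_{u\in U}\ \tfrac12\|u-v\|^2+\lambda\,\mathrm{tv}(u)+\imath_{\mathbb{R}_+}(u)$$ is a dual instance of the Condat-Vu (CV) algorithm applied to this problem. Precisely, write the problem equivalently (dividing by $\lambda$) as $\min_{u\in U} f_\lambda(u)+g(Lu)+h(u)$ with $f_\lambda=\tfrac{1}{2\lambda}\|\cdot-v\|^2$, $g=\|\cdot\|_{2,1}$, $L=\nabla$, $h=\imath_{\mathbb{R}_+}$, and run CV on it with step sizes $\gamma=\lambda$ and $\sigma=1/(\lambda\|\nabla\|^2)$. Then the CV update of $u_{k+1}$ does not depend on the previous iterate $u_k$, and the CV iteration coincides with the GP iteration: if CV is started from any $u_0\in U$ and $w_0\in W$, and GP is started from the same $w_0$, then for all $k\ge 0$ the dual iterates $w_k$ of the two algorithms are equal, and the CV primal iterate $u_{k+1}$ equals the GP primal iterate $u_k$.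
   Context: $U$ is the finite-dimensional real Euclidean space of discretized 3D images, with inner product $\langle\cdot,\cdot\rangle$ and norm $\|\cdot\|$, and $W=U\times U\times U$. $\nabla=(\nabla_x,\nabla_y,\nabla_z)\colon U\to W$ is the (nonzero) linear discrete gradient operator, with operator norm $\|\nabla\|$ and adjoint $\nabla^*=-\mathrm{div}$. For $w\in W$, $|w|_2$ is the component-wise (voxel-wise) Euclidean norm of $w$, $\|w\|_{2,1}=\||w|_2\|_1$, $\|w\|_{2,\infty}=\||w|_2\|_\infty$, and $\mathrm{tv}(u)=\|\nabla u\|_{2,1}$. $\imath_{\mathbb{R}_+}$ is the indicator function ($0$ on the set, $+\infty$ off it) of the set of images with all components non-negative. $\Pi_{\mathbb{R}_+}$ is the component-wise orthogonal projection onto $\mathbb{R}_+$, and $\Pi_1$ is the projection onto the 2-balls of radius $1$ (onto $\{\|\cdot\|_{2,\infty}\le 1\}$), given component-wise by $\Pi_1(w)=w/\max\{1,|w|_2\}$. For a convex, proper, lower semi-continuous function $\phi$, $\mathrm{prox}_\phi(u)=\mathrm{arg\,min}_{w}\{\tfrac12\|u-w\|^2+\phi(w)\}$, and $\phi^*(u)=\sup_w\{\langle u,w\rangle-\phi(w)\}$ is its Legendre–Fenchel conjugate. CV algorithm for $\min_{u} f(u)+g(Lu)+h(u)$ ($f$ convex and differentiable with Lipschitz gradient, $g,h$ convex, proper, lower semi-continuous, $L\colon U\to W$ bounded linear), with step sizes $\gamma,\sigma>0$ and initial points $u_0\in U$, $w_0\in W$: for $k\ge 0$, $$u_{k+1}=\mathrm{prox}_{\gamma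 h}\big(u_k-\gamma L^*w_k-\gamma\nabla f(u_k)\big),\qquad w_{k+1}=\mathrm{prox}_{\sigma g^*}\big(w_k+\sigma L u_{k+1}\big),$$ where $\nabla f$ is the gradient of the function $f$. GP algorithm for the denoising problem with data $v$ and parameter $\lambda$, initial point $w_0\in W$: for $k\ge0$, $$u_k=\Pi_{\mathbb{R}_+}(v+\lambda\,\mathrm{div}\,w_k),\qquad w_{k+1}=\Pi_1\Big(w_k+\tfrac{1}{\lambda\|\nabla\|^2}\nabla u_k\Big).$$ *)

(* Defs.v *)
From HB Require Import structures.
From mathcomp Require Import all_boot all_order all_algebra.
From mathcomp Require Import all_classical all_reals all_analysis.

Set Implicit Arguments.
Unset Strict Implicit.
Unset Printing Implicit Defensive.

Import Order.TTheory GRing.Theory Num.Theory.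
Import numFieldNormedType.Exports.

Local Open Scope classical_set_scope.
Local Open Scope ring_scope.

(* Euclidean structures are given by an inner product [{dot V for idfun}]; the
   norm [`| _ |] of the library is a sup norm on matrices and products and is
   only used for its topology, which in finite dimension is the Euclidean one. *)

Section inner_product_spaces.
Context {R : realType}.

Definition enorm {V : lmodType R} (ip : {dot V for idfun}) (x : V) : R :=
  Num.sqrt (ip x x).

Definition opnorm {U W : lmodType R} (ipU : {dot U for idfun})
    (ipW : {dot W for idfun}) (L : U -> W) : R :=
  sup [set enorm ipW (L x) | x in [set x | enorm ipU x <= 1]].

(* [adjoint], [gradient] and [prox] pick the element with the defining property;
   the default value 0 is only reached when there is none. *)
Definition adjoint {U W : lmodType R} (ipU : {dot U for idfun})
    (ipW : {dot W for idfun}) (L : U -> W) (w : W) : U :=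
  xget 0 [set u | forall x, ipW (L x) w = ipU x u].

Definition gradient {V : normedModType R} (ip : {dot V for idfun})
    (f : V -> R) (x : V) : V :=
  xget 0 [set d | forall y, 'd f x y = ip d y].

Definition argmin {T : Type} (F : T -> \bar R) : set T :=
  [set x | forall y, (F x <= F y)%E].

Definition prox {V : lmodType R} (ip : {dot V for idfun}) (phi : V -> \bar R)
    (u : V) : V :=
  xget 0 (argmin (fun w => (2^-1 * enorm ip (u - w) ^+ 2)%:E + phi w)%E).

Definition conjugate {V : lmodType R} (ip : {dot V for idfun})
    (phi : V -> \bar R) (u : V) : \bar R :=
  ereal_sup [set ((ip u w)%:E - phi w)%E | w in [set: V]].

Definition eindic {T : Type} (A : set T) (x : T) : \bar R :=
  if x \in A then 0%E else +oo%E.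

Definition proper_fun {T : Type} (phi : T -> \bar R) : Prop :=
  (forall x, phi x != -oo%E) /\ (exists x, phi x != +oo%E).

Definition econvex {V : lmodType R} (phi : V -> \bar R) : Prop :=
  forall (x y : V) (t : R), 0 < t < 1 ->
    (phi (t *: x + (1 - t) *: y)%R <= t%:E * phi x + (1 - t)%:E * phi y)%E.

Definition convex_proper_lsc {V : normedModType R} (phi : V -> \bar R) : Prop :=
  [/\ econvex phi, proper_fun phi & lower_semicontinuous phi].

Definition lipschitz_gradient {V : normedModType R} (ip : {dot V for idfun})
    (f : V -> R) : Prop :=
  exists K : R, forall x y,
    enorm ip (gradient ip f x - gradient ip f y) <= K * enorm ip (x - y).

End inner_product_spaces.

Section condat_vu.
Context {R : realType} {U W : normedModType R}.
Variables (f : U -> R) (g : W -> \bar R) (L : {linear U -> W}) (h : U -> \bar R).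
Variables (ipU : {dot U for idfun}) (ipW : {dot W for idfun}).
Variables (gamma sigma : R).

Definition CV_objective (u : U) : \bar R := ((f u)%:E + g (L u) + h u)%E.

Definition CV_admissible : Prop :=
  [/\ [/\ econvex (EFin \o f), forall x, differentiable f x &
          lipschitz_gradient ipU f],
      convex_proper_lsc g, convex_proper_lsc h, continuous L &
      0 < gamma /\ 0 < sigma].

Definition CV_primal_step (u : U) (w : W) : U :=
  prox ipU (fun x => gamma%:E * h x)%E
    (u - gamma *: adjoint ipU ipW L w - gamma *: gradient ipU f u).

Definition CV_dual_step (u : U) (w : W) : W :=
  prox ipW (fun y => sigma%:E * conjugate ipW g y)%E (w + sigma *: L u).

Fixpoint CV (u0 : U) (w0 : W) (k : nat) : U * W :=
  if k is k'.+1 then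
    let: (u, w) := CV u0 w0 k' in
    let u' := CV_primal_step u w in (u', CV_dual_step u' w)
  else (u0, w0).

End condat_vu.

(* Images are flattened: voxels are indexed by ['I_(nx * ny * nz)]. *)
Notation image_space R nx ny nz := 'rV[R]_(nx * ny * nz).
Notation field_space R nx ny nz :=
  (image_space R nx ny nz * image_space R nx ny nz * image_space R nx ny nz)%type.

Section images.
Context {R : realType} {nx ny nz : nat}.
Local Notation U := (image_space R nx ny nz).
Local Notation W := (field_space R nx ny nz).

Definition dotU (u v : U) : R := \sum_i u 0 i * v 0 i.

Definition dotW (w z : W) : R :=
  dotU w.1.1 z.1.1 + dotU w.1.2 z.1.2 + dotU w.2 z.2.

Fact dotU_linear_l (v : U) : linear_for *%R (dotU ^~ v).
Proof.
move=> a x y; rewrite /dotU mulr_sumr -big_split /=; apply: eq_bigr => i _.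
by rewrite !mxE mulrDl mulrA.
Qed.

Fact dotUC (u v : U) : dotU u v = dotU v u.
Proof. by apply: eq_bigr => i _; rewrite mulrC. Qed.

Fact dotU_linear_r (u : U) : linear_for (idfun \; *%R) (dotU u).
Proof. by move=> a x y; rewrite !(dotUC u) dotU_linear_l. Qed.

HB.instance Definition _ := bilinear_isBilinear.Build R U U R *%R (idfun \; *%R)
  dotU (dotU_linear_l, dotU_linear_r).

Fact dotU_hermitian (u v : U) : dotU u v = (-1) ^+ false * idfun (dotU v u).
Proof. by rewrite expr0 mul1r dotUC. Qed.

HB.instance Definition _ := isHermitianSesquilinear.Build R U false idfun
  dotU dotU_hermitian.

Fact dotU_ge0 (u : U) : 0 <= dotU u u.
Proof. by apply: sumr_ge0 => i _; rewrite -expr2 sqr_ge0. Qed.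

Fact dotU_gt0 (u : U) : u != 0 -> 0 < dotU u u.
Proof.
apply: contra_neqT; rewrite -leNgt => u_le0; apply/rowP => i; rewrite mxE.
have /eqP : dotU u u = 0 by apply/eqP; rewrite eq_le u_le0 dotU_ge0.
rewrite psumr_eq0 => [/allP/(_ i (mem_index_enum i))|j _].
  by rewrite -expr2 sqrf_eq0 => /eqP.
by rewrite -expr2 sqr_ge0.
Qed.

HB.instance Definition _ := isDotProduct.Build R U dotU dotU_gt0.

Fact dotWC (w z : W) : dotW w z = dotW z w.
Proof. by rewrite /dotW !(dotUC z.1.1, dotUC z.1.2, dotUC z.2). Qed.

Fact dotW_linear_l (z : W) : linear_for *%R (dotW ^~ z).
Proof.
move=> a x y; rewrite /dotW /= !dotU_linear_l !mulrDr.
by rewrite [RHS]addrACA [X in X + _ = _]addrACA.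
Qed.

Fact dotW_linear_r (w : W) : linear_for (idfun \; *%R) (dotW w).
Proof. by move=> a x y; rewrite !(dotWC w) dotW_linear_l. Qed.

HB.instance Definition _ := bilinear_isBilinear.Build R W W R *%R (idfun \; *%R)
  dotW (dotW_linear_l, dotW_linear_r).

Fact dotW_hermitian (u v : W) : dotW u v = (-1) ^+ false * idfun (dotW v u).
Proof. by rewrite expr0 mul1r dotWC. Qed.

HB.instance Definition _ := isHermitianSesquilinear.Build R W false idfun
  dotW dotW_hermitian.

Fact dotW_gt0 (w : W) : w != 0 -> 0 < dotW w w.
Proof.
rewrite /dotW; case: w => [[x y] z] /=; apply: contra_neqT; rewrite -leNgt => w_le0.
have : dotU x x + dotU y y + dotU z z == 0.
  by rewrite eq_le w_le0 !addr_ge0 ?dotU_ge0.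
rewrite !paddr_eq0 ?addr_ge0 ?dotU_ge0 // => /andP[/andP[x0 y0] z0].
have dotU_eq0 u : dotU u u == 0 -> u = 0.
  by move=> u0; apply/eqP/negP => /negP/dotU_gt0; rewrite (eqP u0) ltxx.
by rewrite (dotU_eq0 _ x0) (dotU_eq0 _ y0) (dotU_eq0 _ z0).
Qed.

HB.instance Definition _ := isDotProduct.Build R W dotW dotW_gt0.

Local Notation normU := (enorm (dotU : {dot U for idfun})).

Definition voxel_norm (w : W) : U :=
  \row_i Num.sqrt (w.1.1 0 i ^+ 2 + w.1.2 0 i ^+ 2 + w.2 0 i ^+ 2).

Definition norm1 (u : U) : R := \sum_i `|u 0 i|.

Definition norm21 (w : W) : R := norm1 (voxel_norm w).

Definition nonneg_images : set U := [set u | forall i, 0 <= u 0 i].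

Definition proj_real (C : set R) (x : R) : R :=
  xget 0 [set p | C p /\ forall q, C q -> `|x - p| <= `|x - q|].

Definition proj_nonneg (u : U) : U := map_mx (proj_real [set t | 0 <= t]) u.

Definition proj_balls (w : W) : W :=
  let scale (u : U) : U := \row_i (u 0 i / Num.max 1 (voxel_norm w 0 i)) in
  (scale w.1.1, scale w.1.2, scale w.2).

Variable D : {linear U -> W}.

Definition tv (u : U) : R := norm21 (D u).

Definition div (w : W) : U := - adjoint dotU dotW D w.

Definition normD : R := opnorm dotU dotW D.

Variables (v : U) (lambda : R).

Definition denoising_objective (u : U) : \bar R :=
  ((2^-1 * normU (u - v) ^+ 2)%:E + (lambda * tv u)%:E + eindic nonneg_images u)%E.

Definition data_term (u : U) : R := (2 * lambda)^-1 * normU (u - v) ^+ 2.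

Definition GP_primal (w : W) : U := proj_nonneg (v + lambda *: div w).

Fixpoint GP (w0 : W) (k : nat) : W :=
  if k is k'.+1 then
    let w := GP w0 k' in
    proj_balls (w + (lambda * normD ^+ 2)^-1 *: D (GP_primal w))
  else w0.

End images.

(* Main.v *)
Require Import Defs.
From HB Require Import structures.
From mathcomp Require Import all_boot all_order all_algebra.
From mathcomp Require Import all_classical all_reals all_analysis.
From mathcomp Require Import ring lra.

(** The two algorithms coincide because each half-step of the Condat-Vu
    iteration is, for this splitting, the corresponding projection step of GP.

    Primal half-step.  The gradient of [data_term v lambda] at [u] is
    [lambda^-1 *: (u - v)], so with step size [gamma = lambda] the point handed
    to the proximal operator is
    [u - lambda *: adjoint w - (u - v) = v + lambda *: div w]: the previous
    primal iterate cancels.  The proximal operator of a positive multiple of the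
    indicator of a set is the projection onto that set, which is voxelwise for
    the non-negative images.  This is [CV_primal_stepE].

    Dual half-step.  The conjugate of a positively homogeneous function is the
    indicator of its polar set ([conjugate_homogeneous]); for [norm21] the polar
    set is the set of fields whose voxelwise Euclidean norm is at most 1
    ([polar_norm21], by the Cauchy-Schwarz inequality in each voxel).  Hence the
    dual proximal operator is the projection [proj_balls], whatever the step
    size [sigma > 0] ([prox_balls]).  Both projections are identified through
    the variational inequality of [prox_indicator_variational].

    An induction on the iteration number then gives the equality of the two
    algorithms.  What remains is that the splitting satisfies the hypotheses of
    the Condat-Vu algorithm: convexity, semicontinuity and smoothness are checked
    coordinate by coordinate, and [sigma > 0] amounts to [0 < normD D], where
    finiteness of the operator norm is the point to establish, since the supremum
    of an unbounded set is 0 ([linear_unit_ball_bounded]). *)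

Import Order.TTheory GRing.Theory Num.Theory.
Import numFieldNormedType.Exports.

Local Open Scope classical_set_scope.
Local Open Scope ring_scope.

(** * Inner products, proximal operators and conjugates *)

Section inner_product.
Context {R : realType} {V : lmodType R} (ip : {dot V for idfun}).

Lemma ip_gt0 (x : V) : x != 0 -> 0 < ip x x.
Proof. exact: neq0_dnorm_gt0. Qed.

Lemma ip_ge0 (x : V) : 0 <= ip x x.
Proof. by have [->|/ip_gt0/ltW//] := eqVneq x 0; rewrite linear0. Qed.

Lemma sqr_enorm (x : V) : enorm ip x ^+ 2 = ip x x.
Proof. by rewrite /enorm sqr_sqrtr// ip_ge0. Qed.

Lemma sqr_enormB (x y : V) :
  enorm ip (x - y) ^+ 2 = enorm ip x ^+ 2 + enorm ip y ^+ 2 - 2 * ip x y.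
Proof. by rewrite !sqr_enorm hnormB /= expr0 mul1r; ring. Qed.

Lemma enorm_gt0 (x : V) : x != 0 -> 0 < enorm ip x.
Proof. by move=> x0; rewrite sqrtr_gt0 ip_gt0. Qed.

Lemma enormZ (t : R) (x : V) : 0 <= t -> enorm ip (t *: x) = t * enorm ip x.
Proof.
move=> t0; rewrite /enorm linearZl linearZr /= mulrA -expr2 sqrtrM ?sqr_ge0//.
by rewrite sqrtr_sqr ger0_norm.
Qed.

(** The variational inequality says that the angle at [p] between [u] and any
    point [q] of [A] is at least a right angle, hence
    [|u - q|^2 >= |u - p|^2 + |q - p|^2], which makes [p] the only minimizer. *)
Lemma prox_indicator_variational (A : set V) (c : R) (u p : V) : 0 < c -> A p ->
  (forall q, A q -> ip (u - p) (q - p) <= 0) ->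
  prox ip (fun x => c%:E * eindic A x)%E u = p.
Proof.
move=> c_gt0 Ap p_proj.
have dist q : A q ->
    enorm ip (u - p) ^+ 2 + enorm ip (q - p) ^+ 2 <= enorm ip (u - q) ^+ 2.
  move=> /p_proj uq_le0.
  have -> : u - q = (u - p) - (q - p) by rewrite opprB addrA subrK.
  by rewrite [leRHS]sqr_enormB; lra.
have phiA q : A q -> (c%:E * eindic A q = 0)%E.
  by move=> Aq; rewrite /eindic mem_set// mule0.
have phinA q : ~ A q -> (c%:E * eindic A q = +oo)%E.
  by move=> nAq; rewrite /eindic memNset// gt0_muley ?lte_fin.
apply: xget_unique => [q /=|q /(_ p)/=].
  have [Aq|nAq] := pselect (A q).
    rewrite !phiA// !adde0 lee_fin ler_pM2l ?invr_gt0//.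
    by apply: le_trans (dist _ Aq); rewrite lerDl sqr_ge0.
  by rewrite (phinA q nAq) addey// leey.
have [Aq|nAq] := pselect (A q); last first.
  by rewrite (phiA p)// phinA// addey// adde0 leye_eq.
rewrite !phiA// !adde0 lee_fin ler_pM2l ?invr_gt0// => le_q.
apply/eqP; rewrite -subr_eq0; apply/negPn/negP => /ip_gt0.
rewrite -sqr_enorm => qp; have := dist _ Aq; lra.
Qed.

(** Scaling [x] by [t >= 0] scales [ip w x - phi x] by [t]: the supremum is 0,
    reached at 0, if this gap is never positive, and is infinite otherwise. *)
Lemma conjugate_homogeneous (phi : V -> R) :
  (forall t x, 0 <= t -> phi (t *: x) = t * phi x) ->
  conjugate ip (EFin \o phi) = eindic [set w | forall x, ip w x <= phi x].
Proof.
move=> phiZ; apply/funext => w; rewrite /conjugate /eindic.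
have phi0 : phi 0 = 0 by rewrite -(scale0r 0) phiZ// mul0r.
case: ifPn => [|]; [rewrite inE /= => w_le|rewrite notin_setE /= => w_nle].
  apply/eqP; rewrite eq_le; apply/andP; split.
    apply: ge_ereal_sup => _ [x _ <-] /=.
    by rewrite -EFinB lee_fin subr_le0.
  apply: ereal_sup_ubound; exists 0 => //=.
  by rewrite phi0 linear0 sube0.
have {w_nle} [x x_gt] : exists x, phi x < ip w x.
  apply: contrapT => no_x; apply: w_nle => x; rewrite leNgt; apply/negP => x_gt.
  by apply: no_x; exists x.
have gap_gt0 : 0 < ip w x - phi x by rewrite subr_gt0.
apply/eqyP => a a_gt0; apply: ereal_sup_ubound.
(* scaling [x] so as to turn its positive gap into [a] *)
exists ((a / (ip w x - phi x)) *: x) => //=.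
have t_ge0 : 0 <= a / (ip w x - phi x) by rewrite divr_ge0// ltW.
by rewrite linearZ /= phiZ// -EFinB -mulrBr divfK// gt_eqF.
Qed.

End inner_product.

Lemma gradient_unique {R : realType} {V : normedModType R}
    (ip : {dot V for idfun}) (f : V -> R) (x d : V) :
  (forall y, 'd f x y = ip d y) -> gradient ip f x = d.
Proof.
move=> fd; apply: xget_unique => //= e fe; apply/eqP; rewrite -subr_eq0.
apply/negPn/negP => /(ip_gt0 ip).
by rewrite linearBl /= -fd -fe subrr ltxx.
Qed.

(** * Convexity and lower semicontinuity of extended-real functions *)

Lemma econvex_EFin {R : realType} {V : lmodType R} (f : V -> R) :
  (forall x y t, 0 < t < 1 ->
    f (t *: x + (1 - t) *: y) <= t * f x + (1 - t) * f y) ->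
  econvex (EFin \o f).
Proof. by move=> cf x y t t01; rewrite /= lee_fin cf. Qed.

Lemma continuous_EFin_lsc {R : realType} {V : topologicalType} (f : V -> R) :
  continuous f -> lower_semicontinuous (EFin \o f).
Proof.
move=> cf x a; rewrite /= lte_fin => afx.
exists [set y | a < f y] => [|y]; last by rewrite lte_fin.
apply: (cf x [set t | a < t]); apply: open_nbhs_nbhs.
by split=> //; exact: open_gt.
Qed.

Lemma closed_eindic_lsc {R : realType} {V : topologicalType} (A : set V) :
  closed A -> lower_semicontinuous (@eindic R V A).
Proof.
move=> cA x a; rewrite {1}/eindic; case: ifPn; rewrite ?inE ?notin_setE;
  move=> Ax ax.
  exists setT => [|y _]; first exact: filterT.
  by rewrite /eindic; case: ifP => // _; rewrite ltry.
exists (~` A) => [|y nAy].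
  by apply: open_nbhs_nbhs; split; first exact: closed_openC.
by rewrite /eindic memNset// ltry.
Qed.

Lemma econvex_eindic {R : realType} {V : lmodType R} (A : set V) :
  (forall x y t, 0 < t < 1 -> A x -> A y -> A (t *: x + (1 - t) *: y)) ->
  econvex (@eindic R V A).
Proof.
move=> cA x y t t01; have /andP[t0 t1] := t01.
have t1' : 0 < 1 - t by rewrite subr_gt0.
rewrite {2 3}/eindic; case: ifPn => [|_]; last first.
  rewrite gt0_muley ?lte_fin// addye ?leey//.
  by case: ifP => _; rewrite ?mule0// gt0_muley ?lte_fin.
case: ifPn => [|_ _]; last by rewrite gt0_muley ?lte_fin// mule0 addey// leey.
by rewrite !inE !mule0 adde0 /eindic => Ay Ax; rewrite mem_set//; apply: cA.
Qed.

(** * Voxelwise projections *)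

Lemma proj_real_nonneg {R : realType} (x : R) :
  proj_real [set t | 0 <= t] x = Num.max 0 x.
Proof.
apply: xget_unique => /= [|p [p_ge0]].
  split=> [|q q_ge0]; first by rewrite le_max lexx.
  case: (leP 0 x) => [_|x_lt0]; first by rewrite subrr normr0.
  by rewrite !ler0_norm; lra.
move=> /(_ (Num.max 0 x)); rewrite le_max lexx => /(_ isT).
case: (leP 0 x) => [x_ge0|x_lt0].
  by rewrite subrr normr0 normr_le0 => /eqP; lra.
by rewrite !ler0_norm; lra.
Qed.

Section voxelwise.
Context {R : realType} {nx ny nz : nat}.
Local Notation U := (image_space R nx ny nz).
Local Notation W := (field_space R nx ny nz).
Implicit Types (u v : U) (w z : W).

Lemma prox_nonneg (c : R) u : 0 < c ->
  prox dotU (fun x => c%:E * eindic nonneg_images x)%E u = proj_nonneg u.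
Proof.
move=> c_gt0; apply: prox_indicator_variational => // [i|q q_ge0].
  by rewrite mxE proj_real_nonneg le_max lexx.
rewrite /= /dotU sumr_le0// => i _; rewrite !mxE proj_real_nonneg.
have := q_ge0 i; set a := u 0 i; set b := q 0 i.
by case: (leP 0 a); nra.
Qed.

Definition vdot w z i : R :=
  w.1.1 0 i * z.1.1 0 i + w.1.2 0 i * z.1.2 0 i + w.2 0 i * z.2 0 i.

Lemma dotWE w z : dotW w z = \sum_i vdot w z i.
Proof. by rewrite /dotW /dotU -!big_split. Qed.

Lemma voxel_norm_ge0 w i : 0 <= voxel_norm w 0 i.
Proof. by rewrite mxE sqrtr_ge0. Qed.

Lemma sqr_voxel_norm w i : voxel_norm w 0 i ^+ 2 = vdot w w i.
Proof. by rewrite mxE sqr_sqrtr ?addr_ge0 ?sqr_ge0// /vdot !expr2. Qed.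

Lemma voxel_norm_unique w i (r : R) : 0 <= r -> r ^+ 2 = vdot w w i ->
  voxel_norm w 0 i = r.
Proof.
move=> r_ge0; rewrite -sqr_voxel_norm => /eqP.
by rewrite eqrXn2 ?voxel_norm_ge0// => /eqP.
Qed.

Lemma norm21E w : norm21 w = \sum_i voxel_norm w 0 i.
Proof.
by apply: eq_bigr => i _; rewrite ger0_norm ?voxel_norm_ge0.
Qed.

Lemma vdot_CauchySchwarz w z i :
  vdot w z i <= voxel_norm w 0 i * voxel_norm z 0 i.
Proof.
rewrite -[leRHS]ger0_norm ?mulr_ge0 ?voxel_norm_ge0// -sqrtr_sqr exprMn.
apply: le_trans (ler_norm _) _.
rewrite -sqrtr_sqr ler_wsqrtr// !sqr_voxel_norm /vdot.
set a := w.1.1 0 i; set b := w.1.2 0 i; set c := w.2 0 i.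
set a' := z.1.1 0 i; set b' := z.1.2 0 i; set c' := z.2 0 i.
rewrite -subr_ge0.
(* Lagrange's identity *)
have -> : (a * a + b * b + c * c) * (a' * a' + b' * b' + c' * c') -
    (a * a' + b * b' + c * c') ^+ 2 = (a * b' - b * a') ^+ 2 +
    (b * c' - c * b') ^+ 2 + (a * c' - c * a') ^+ 2 by ring.
by rewrite !addr_ge0 ?sqr_ge0.
Qed.

Lemma vdotD w z i :
  vdot (w + z) (w + z) i = vdot w w i + 2 * vdot w z i + vdot z z i.
Proof. by rewrite /vdot /= !mxE; ring. Qed.

Lemma vdotBB w w' z z' i :
  vdot (w - w') (z - z') i =
  vdot w z i - vdot w z' i - vdot w' z i + vdot w' z' i.
Proof. by rewrite /vdot /= !mxE; ring. Qed.

Lemma voxel_normD w z i :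
  voxel_norm (w + z) 0 i <= voxel_norm w 0 i + voxel_norm z 0 i.
Proof.
rewrite -ler_sqr ?nnegrE ?addr_ge0 ?voxel_norm_ge0//.
have := vdot_CauchySchwarz w z i.
rewrite sqrrD !sqr_voxel_norm vdotD; lra.
Qed.

Lemma voxel_normZ t w i : 0 <= t ->
  voxel_norm (t *: w) 0 i = t * voxel_norm w 0 i.
Proof.
move=> t_ge0; apply: voxel_norm_unique.
  by rewrite mulr_ge0 ?voxel_norm_ge0.
by rewrite exprMn sqr_voxel_norm /vdot /= !mxE; ring.
Qed.

Lemma norm21Z t w : 0 <= t -> norm21 (t *: w) = t * norm21 w.
Proof.
move=> t_ge0; rewrite !norm21E mulr_sumr.
by apply: eq_bigr => i _; rewrite voxel_normZ.
Qed.

Lemma norm21_convex (x y : W) (t : R) : 0 < t < 1 ->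
  norm21 (t *: x + (1 - t) *: y) <= t * norm21 x + (1 - t) * norm21 y.
Proof.
case/andP=> t0 t1; rewrite -!norm21Z; [|lra..].
by rewrite !norm21E -big_split ler_sum// => i _; apply: voxel_normD.
Qed.

Definition voxel_restriction w i : W :=
  (w.1.1 0 i *: delta_mx 0 i, w.1.2 0 i *: delta_mx 0 i,
   w.2 0 i *: delta_mx 0 i).

(** Testing [w] against its own restriction to the voxel [i] gives
    [r ^+ 2 <= r] for the norm [r] of [w] there, that is [r <= 1]; conversely,
    summing the voxelwise Cauchy-Schwarz inequalities gives the polar bound. *)
Lemma polar_norm21 : [set w : W | forall z, dotW w z <= norm21 z] =
  [set w | forall i, voxel_norm w 0 i <= 1].
Proof.
apply/seteqP; split=> w /= w_le.
  move=> i.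
  have vE z j : vdot z (voxel_restriction w i) j = (j == i)%:R * vdot z w j.
    rewrite /vdot /voxel_restriction /= !mxE eqxx/=.
    by case: eqP => [->|_]; rewrite ?mulr1 ?mulr0 ?mul1r ?mul0r ?addr0.
  have nE j :
      voxel_norm (voxel_restriction w i) 0 j = (j == i)%:R * voxel_norm w 0 j.
    apply: voxel_norm_unique; first by rewrite mulr_ge0 ?voxel_norm_ge0.
    rewrite exprMn sqr_voxel_norm vE /vdot /voxel_restriction /= !mxE eqxx /=.
    case: eqP => [->|_]; first by rewrite ?mulr1 expr1n mul1r.
    by rewrite ?mulr0 ?mul0r ?addr0 expr0n mul0r.
  have := w_le (voxel_restriction w i); rewrite dotWE norm21E.
  rewrite (bigD1 i)//= big1 ?addr0; last first.
    by move=> j /negPf ji; rewrite vE ji mul0r.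
  rewrite (bigD1 i)//= big1 ?addr0; last first.
    by move=> j /negPf ji; rewrite nE ji mul0r.
  rewrite vE nE eqxx !mul1r -sqr_voxel_norm.
  by have := voxel_norm_ge0 w i; nra.
move=> z; rewrite dotWE norm21E ler_sum// => i _.
apply: le_trans (vdot_CauchySchwarz w z i) _.
by rewrite ler_piMl ?voxel_norm_ge0.
Qed.

Lemma proj_ballsE w i (m := Num.max 1 (voxel_norm w 0 i)) :
  [/\ (proj_balls w).1.1 0 i = w.1.1 0 i / m,
      (proj_balls w).1.2 0 i = w.1.2 0 i / m &
      (proj_balls w).2 0 i = w.2 0 i / m].
Proof. by split; rewrite mxE. Qed.

(** In a voxel where [w] has norm [r > 1], the projection is [w / r] and the
    variational inequality reads [(1 - r^-1) * (<w, q> - r) <= 0], which is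
    Cauchy-Schwarz for [|q| <= 1]; elsewhere [w] is its own projection. *)
Lemma prox_balls (c : R) w : 0 < c ->
  prox dotW (fun y => c%:E * conjugate dotW (EFin \o norm21) y)%E w
  = proj_balls w.
Proof.
move=> c_gt0; rewrite conjugate_homogeneous; last by move=> t x; exact: norm21Z.
rewrite /= polar_norm21.
apply: prox_indicator_variational => // [i|q /= q_le].
  set m := Num.max 1 (voxel_norm w 0 i).
  have m_ge1 : 1 <= m by rewrite le_max lexx.
  have m_gt0 : 0 < m by lra.
  rewrite (@voxel_norm_unique _ _ (voxel_norm w 0 i / m)).
  - by rewrite ler_pdivrMr// mul1r le_max lexx orbT.
  - by rewrite divr_ge0 ?voxel_norm_ge0// ltW.
  - rewrite exprMn sqr_voxel_norm /vdot.
    by have [-> -> ->] := proj_ballsE w i; rewrite -/m; ring.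
rewrite dotWE sumr_le0// => i _.
set m := Num.max 1 (voxel_norm w 0 i).
have m_ge1 : 1 <= m by rewrite le_max lexx.
have m_gt0 : 0 < m by lra.
have -> : vdot (w - proj_balls w) (q - proj_balls w) i =
  (1 - m^-1) * (vdot w q i - vdot w w i / m).
  rewrite vdotBB /vdot.
  by have [-> -> ->] := proj_ballsE w i; rewrite -/m; ring.
have := vdot_CauchySchwarz w q i; have := q_le i.
have := voxel_norm_ge0 w i; have := voxel_norm_ge0 q i.
rewrite -sqr_voxel_norm {}/m in m_ge1 m_gt0 *.
set r := voxel_norm w 0 i; set s := voxel_norm q 0 i.
case: (leP r 1) => [_ *|r_gt1 s_ge0 r_ge0 s_le1 wq].
  by rewrite invr1 subrr mul0r.
rewrite expr2 mulfK ?gt_eqF//; last lra.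
apply: mulr_ge0_le0; first by rewrite subr_ge0 invf_le1; lra.
nra.
Qed.

End voxelwise.

(** * Regularizer, constraint and operator *)

Section hypotheses.
Context {R : realType} {nx ny nz : nat}.
Local Notation U := (image_space R nx ny nz).
Local Notation W := (field_space R nx ny nz).
Implicit Types (u : U) (w : W).

Lemma convex_proper_lsc_norm21 : convex_proper_lsc (EFin \o @norm21 R nx ny nz).
Proof.
split; first by apply: econvex_EFin; exact: norm21_convex.
  by split=> //; exists 0.
apply: continuous_EFin_lsc.
have -> : @norm21 R nx ny nz = fun w => \sum_i voxel_norm w 0 i.
  by apply/funext => w; rewrite norm21E.
move=> w; apply: (cvg_big add_continuous) => i _.
under eq_fun do rewrite mxE.
rewrite mxE; apply: continuous_comp; last exact: sqrt_continuous.
have coordc (p : W -> U) : {for w, continuous p} ->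
    {for w, continuous (fun w => p w 0 i)}.
  move=> pc; apply: (@continuous_comp _ _ _ p (fun u => u 0 i)) => //.
  exact: coord_continuous.
have c11 : {for w, continuous (fun w : W => w.1.1 0 i)}.
  by apply: coordc; apply: continuous_comp; exact: cvg_fst.
have c12 : {for w, continuous (fun w : W => w.1.2 0 i)}.
  by apply: coordc; apply: continuous_comp; [exact: cvg_fst|exact: cvg_snd].
have c2 : {for w, continuous (fun w : W => w.2 0 i)}.
  by apply: coordc; exact: cvg_snd.
by apply: cvgD; [apply: cvgD|]; apply: cvgM.
Qed.

Lemma convex_proper_lsc_nonneg :
  convex_proper_lsc (@eindic R U nonneg_images).
Proof.
split.
- apply: econvex_eindic => x y t /andP[t0 t1] x0 y0 i; rewrite !mxE.
  by rewrite addr_ge0// mulr_ge0// ?subr_ge0 ltW.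
- split=> [x|]; first by rewrite /eindic; case: ifP.
  exists 0; rewrite /eindic mem_set//= => i; rewrite mxE//.
- apply: closed_eindic_lsc.
  have -> : nonneg_images = \bigcap_(i in [set: 'I_(nx * ny * nz)])
      (fun u : U => u 0 i) @^-1` [set t | 0 <= t].
    by apply/seteqP; split=> u /= u0 i; [move=> _|]; exact: u0.
  apply: closed_bigI => i _; apply: closed_comp => [u _|].
    exact: coord_continuous.
  exact: closed_ge.
Qed.

Context (D : {linear U -> W}).

Lemma linear_delta u : D u = \sum_i u 0 i *: D (delta_mx 0 i).
Proof.
rewrite {1}(row_sum_delta u) linear_sum.
by apply: eq_bigr => i _; rewrite linearZ.
Qed.

Lemma linear_image_continuous : continuous D.
Proof.
have -> : (D : U -> W) = fun u => \sum_i u 0 i *: D (delta_mx 0 i).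
  by apply/funext => u; rewrite linear_delta.
move=> u; apply: (@cvg_big W _ +%R 0 xpredT add_continuous _ (nbhs u)) => i _.
apply: (@continuous_comp _ _ _ (fun u : U => u 0 i)
  ( *:%R^~ (D (delta_mx 0 i)))).
  exact: coord_continuous.
exact: scalel_continuous.
Qed.

(** Expanding along the canonical basis, [dotW (D x) (D x)] is a quadratic form
    in the coordinates of [x], all of absolute value at most 1 in the unit ball:
    it is bounded by the sum of the absolute values of the coefficients. *)
Lemma linear_unit_ball_bounded :
  has_ubound [set enorm dotW (D x) | x in [set x | enorm dotU x <= 1]].
Proof.
pose a i j := dotW (D (delta_mx 0 i)) (D (delta_mx 0 j)).
exists (Num.sqrt (\sum_i \sum_j `|a i j|)) => _ [x /= x_le1 <-].
have xi_le1 i : `|x 0 i| <= 1.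
  rewrite -(@expr_le1 _ 2)// real_normK ?num_real//.
  have : enorm dotU x ^+ 2 <= 1 by rewrite expr_le1// sqrtr_ge0.
  rewrite sqr_enorm /= /dotU (bigD1 i)//= expr2; apply: le_trans.
  by rewrite lerDl sumr_ge0// => j _; rewrite -expr2 sqr_ge0.
apply: ler_wsqrtr; rewrite linear_delta linear_sumlz.
apply: ler_sum => i _; rewrite linear_sumr; apply: ler_sum => j _.
rewrite linearZl linearZr /= mulrA -/(a i j).
apply: le_trans (ler_norm _) _; rewrite !normrM ler_piMl//.
by rewrite mulr_ile1.
Qed.

Lemma normD_gt0 : (exists u, D u != 0) -> 0 < normD D.
Proof.
move=> [u Du_neq0].
have u_neq0 : u != 0 by apply: contraNneq Du_neq0 => ->; rewrite linear0.
pose x := (enorm dotU u)^-1 *: u.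
apply: (@lt_le_trans _ _ (enorm dotW (D x))).
  rewrite /x linearZ /= enormZ ?invr_ge0 ?sqrtr_ge0//.
  by rewrite mulr_gt0// ?invr_gt0 enorm_gt0.
apply: (ub_le_sup linear_unit_ball_bounded); exists x => //=.
by rewrite enormZ ?invr_ge0 ?sqrtr_ge0// mulVf// gt_eqF// enorm_gt0.
Qed.

End hypotheses.

(** * The quadratic data term *)

Lemma is_diff_sum {R : realType} {V W : normedModType R} (I : Type) (r : seq I)
    (f df : I -> V -> W) (x : V) :
  (forall i, is_diff x (f i) (df i)) ->
  is_diff x (\sum_(i <- r) f i) (\sum_(i <- r) df i).
Proof.
move=> fd; apply: (big_ind2 (fun f df => is_diff x f df)) => //.
- exact: is_diff_cst.
- by move=> f1 df1 f2 df2 d1 d2; exact: is_diffD.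
Qed.

Lemma is_diff_coord {R : realType} {m n : nat} (M : 'M[R]_(m, n)) i j :
  is_diff M (fun N : 'M[R]_(m, n) => N i j : R) (fun N => N i j).
Proof.
have lin : linear (fun N : 'M[R]_(m, n) => N i j : R).
  by move=> a A B; rewrite !mxE.
pose coordM := GRing.isLinear.Build _ _ _ _ _ lin.
pose coord : {linear 'M[R]_(m, n) -> R} :=
  HB.pack (fun N : 'M[R]_(m, n) => N i j : R) coordM.
apply: DiffDef; first exact: differentiable_coord.
by rewrite -[fun _ => _]/(coord : _ -> _) diff_lin//; exact: coord_continuous.
Qed.

Section data_term.
Context {R : realType} {nx ny nz : nat}.
Local Notation U := (image_space R nx ny nz).
Local Notation W := (field_space R nx ny nz).
Context (v : U) (lambda : R) (lambda_gt0 : 0 < lambda).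

Lemma data_termE (u : U) :
  data_term v lambda u = \sum_i (2 * lambda)^-1 * (u 0 i - v 0 i) ^+ 2.
Proof.
rewrite /data_term sqr_enorm /= /dotU mulr_sumr.
by apply: eq_bigr => i _; rewrite !mxE expr2.
Qed.

Lemma is_diff_data_term (u : U) :
  is_diff u (data_term v lambda) (dotU (lambda^-1 *: (u - v))).
Proof.
have -> : data_term v lambda =
    \sum_i (2 * lambda)^-1 *: ((fun x : U => x 0 i) - cst (v 0 i)) ^+ 2.
  by apply/funext => x; rewrite data_termE fct_sumE; apply: eq_bigr.
apply: is_diff_eq.
  apply: is_diff_sum => i; apply: is_diffZ; apply: is_diffX; apply: is_diffB.
  exact: is_diff_coord.
apply/funext => x; rewrite fct_sumE; apply: eq_bigr => i _.
rewrite !mxE /= subr0 expr1 /GRing.scale /=.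
rewrite !fctE /GRing.scale /=.
by field; exact: lt0r_neq0.
Qed.

Lemma gradient_data_term (u : U) :
  gradient dotU (data_term v lambda) u = lambda^-1 *: (u - v).
Proof.
apply: gradient_unique => y; have d := is_diff_data_term u.
by rewrite diff_val.
Qed.

Lemma convex_data_term : econvex (EFin \o data_term v lambda).
Proof.
apply: econvex_EFin => x y t /andP[t0 t1].
rewrite !data_termE !mulr_sumr -big_split ler_sum//= => i _.
rewrite !mxE ![_ * ((2 * lambda)^-1 * _)]mulrCA -mulrDr.
rewrite ler_pM2l ?invr_gt0 ?mulr_gt0//.
set a := x 0 i; set b := y 0 i; set c := v 0 i.
rewrite -subr_ge0.
have -> : t * (a - c) ^+ 2 + (1 - t) * (b - c) ^+ 2 -
  (t * a + (1 - t) * b - c) ^+ 2 = t * (1 - t) * (a - b) ^+ 2 by ring.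
by apply: mulr_ge0; [apply: mulr_ge0; lra|exact: sqr_ge0].
Qed.

Lemma lipschitz_data_term : lipschitz_gradient dotU (data_term v lambda).
Proof.
exists lambda^-1 => x y; rewrite !gradient_data_term -scalerBr.
rewrite opprB addrA subrK.
by rewrite enormZ// invr_ge0 ltW.
Qed.

(** With step size [lambda], the gradient step subtracts exactly [u - v], so the
    primal iterate [u] disappears. *)
Lemma CV_primal_stepE (D : {linear U -> W}) u w :
  CV_primal_step (data_term v lambda) D (eindic nonneg_images) dotU dotW lambda
    u w
  = GP_primal D v lambda w.
Proof.
rewrite /CV_primal_step gradient_data_term prox_nonneg// /GP_primal /div.
congr proj_nonneg.
rewrite scalerA divff ?lt0r_neq0// scale1r scalerN opprB.
by rewrite addrC addrA subrK addrC.
Qed.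

Lemma CV_objectiveE (D : {linear U -> W}) u :
  CV_objective (data_term v lambda) (EFin \o norm21) D (eindic nonneg_images) u
  = (lambda^-1%:E * denoising_objective D v lambda u)%E.
Proof.
have li_gt0 : (0 < (lambda^-1)%:E)%E by rewrite lte_fin invr_gt0.
rewrite /CV_objective /denoising_objective /eindic; case: ifP => _ /=.
  rewrite !adde0 -!EFinD -EFinM /data_term /tv; congr (_%:E).
  by field; exact: lt0r_neq0.
by rewrite !addey// gt0_muley.
Qed.

End data_term.

(** * Equality of the two algorithms *)

Theorem proposition1 (R : realType) (nx ny nz : nat)
    (D : {linear image_space R nx ny nz -> field_space R nx ny nz})
    (v : image_space R nx ny nz) (lambda : R)
    (D_neq0 : exists u, D u != 0) (lambda_gt0 : 0 < lambda) :
  let f := data_term v lambda in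
  let g := EFin \o norm21 in
  let h := eindic nonneg_images in
  let gamma := lambda in
  let sigma := (lambda * normD D ^+ 2)^-1 in
  [/\ forall u, CV_objective f g D h u
                = (lambda^-1%:E * denoising_objective D v lambda u)%E,
      CV_admissible f g D h dotU gamma sigma,
      forall w u u', CV_primal_step f D h dotU dotW gamma u w
                     = CV_primal_step f D h dotU dotW gamma u' w &
      forall u0 w0 k,
        (CV f g D h dotU dotW gamma sigma u0 w0 k).2 = GP D v lambda w0 k /\
        (CV f g D h dotU dotW gamma sigma u0 w0 k.+1).1
          = GP_primal D v lambda (GP D v lambda w0 k)].
Proof.
move=> f g h gamma sigma.
have sigma_gt0 : 0 < sigma.
  by rewrite invr_gt0 mulr_gt0// exprn_gt0// normD_gt0.
have primalE u w :
    CV_primal_step f D h dotU dotW gamma u w = GP_primal D v lambda w.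
  exact: CV_primal_stepE.
have dualE u0 w0 k :
    (CV f g D h dotU dotW gamma sigma u0 w0 k).2 = GP D v lambda w0 k.
  elim: k => //= k <-; case: (CV _ _ _ _ _ _ _ _ _ _ k) => u w /=.
  by rewrite primalE /CV_dual_step prox_balls.
split=> [u||w u u'|u0 w0 k].
- exact: CV_objectiveE.
- split=> //.
  + split; [exact: convex_data_term| |exact: lipschitz_data_term].
    by move=> u; have [] := is_diff_data_term v lambda lambda_gt0 u.
  + exact: convex_proper_lsc_norm21.
  + exact: convex_proper_lsc_nonneg.
  + exact: linear_image_continuous.
- by rewrite !primalE.
- split; first exact: dualE.
  rewrite -(dualE u0) /=; case: (CV _ _ _ _ _ _ _ _ _ _ k) => u w /=.
  exact: primalE.
Qed.
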